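(* Let $n\ge2$ and let $f$ be a Möbius transformation of $\overline{\mathbb{R}}^n$ with $f(\mathbb{H}^n)=\mathbb{B}^n$. Then for all $x,y\in\mathbb{H}^n$, $$\tfrac12\tilde\tau_{\mathbb{H}^n}(x,y)\le\tilde\tau_{\mathbb{B}^n}(f(x),f(y))\le2\tilde\tau_{\mathbb{H}^n}(x,y),$$ and the constants $\tfrac12$ and $2$ are best possible, i.e. $$\inf_{x\ne y}\frac{\tilde\tau_{\mathbb{B}^n}(f(x),f(y))}{\tilde\tau_{\mathbb{H}^n}(x,y)}=\tfrac12,\qquad \sup_{x\ne y}\frac{\tilde\tau_{\mathbb{B}^n}(f(x),f(y))}{\tilde\tau_{\mathbb{H}^n}(x,y)}=2.$$
   Context: $\mathbb{B}^n=\{z\in\mathbb{R}^n:|z|<1\}$, $\mathbb{H}^n=\{x\in\mathbb{R}^n:x_n>0\}$ (boundary taken in $\mathbb{R}^n$), $\overline{\mathbb{R}}^n=\mathbb{R}^n\cup\{\infty\}$. For a proper subdomain $D\subsetneq\mathbb{R}^n$ and $x,y\in D$, $\tilde\tau_D(x,y)=\log\big(1+\sup_{p\in\partial D}\frac{|x-y|}{\sqrt{|x-p||y-p|}}\big)$ (the scale invariant Cassinian metric). *)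

(* Defs.v *)
From mathcomp Require Import all_boot.
From Stdlib Require Import Reals ClassicalEpsilon.

Set Implicit Arguments.
Unset Strict Implicit.
Unset Printing Implicit Defensive.

Local Open Scope R_scope.

Definition vec (n : nat) := 'I_n -> R.

(* The extended space R^n ∪ {∞}: [Some x] is the finite point x, [None] is ∞. *)
Definition point (n : nat) := option (vec n).

Definition dot (n : nat) (x y : vec n) : R := \big[Rplus/0]_(i < n) (x i * y i).
Definition vsub (n : nat) (x y : vec n) : vec n := fun i => x i - y i.
Definition vnorm (n : nat) (x : vec n) : R := sqrt (dot x x).
Definition dist (n : nat) (x y : vec n) : R := vnorm (vsub x y).

Definition unit_ball (n : nat) (z : vec n) : Prop := vnorm z < 1.
(* H^n = {x : x_n > 0}; the n-th coordinate is the index n-1 of 'I_n. *)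
Definition upper_half (n : nat) (x : vec n) : Prop :=
  forall i : 'I_n, nat_of_ord i = n.-1 -> 0 < x i.

Definition boundary (n : nat) (D : vec n -> Prop) (p : vec n) : Prop :=
  forall eps, 0 < eps ->
    (exists q, D q /\ dist q p < eps) /\ (exists q, ~ D q /\ dist q p < eps).

Definition Rsup (E : R -> Prop) : R :=
  match excluded_middle_informative (exists l, is_lub E l) with
  | left h => proj1_sig (constructive_indefinite_description _ h)
  | right _ => 0
  end.

Definition is_glb (E : R -> Prop) (m : R) : Prop :=
  (forall x, E x -> m <= x) /\ (forall b, (forall x, E x -> b <= x) -> b <= m).

Definition cassinian_tilde (n : nat) (D : vec n -> Prop) (x y : vec n) : R :=
  ln (1 + Rsup (fun v => exists p, boundary D p /\
                   v = dist x y / sqrt (dist x p * dist y p))).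

Definition refl_plane (n : nat) (a : vec n) (t : R) (z : point n) : point n :=
  match z with
  | None => None
  | Some x => Some (fun i => x i - 2 * (dot x a - t) / dot a a * a i)
  end.

Definition refl_sphere (n : nat) (a : vec n) (r : R) (z : point n) : point n :=
  match z with
  | None => Some a
  | Some x =>
      if excluded_middle_informative (x = a) then None
      else Some (fun i => a i + r ^ 2 * (x i - a i) / dot (vsub x a) (vsub x a))
  end.

Inductive mobius (n : nat) : (point n -> point n) -> Prop :=
| mobius_id : mobius (fun z => z)
| mobius_plane (a : vec n) (t : R) (f : point n -> point n) :
    (exists i, a i <> 0) -> mobius f -> mobius (fun z => refl_plane a t (f z))
| mobius_sphere (a : vec n) (r : R) (f : point n -> point n) :
    0 < r -> mobius f -> mobius (fun z => refl_sphere a r (f z)).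

(* Main.v *)
(* A Möbius map is a bijection of the extended space multiplying the distance
   (with the conventions |x - oo| = 1, |oo - oo| = 0) by a product of one-point
   weights. As the half-space is unbounded and the ball is not, [f] has a
   finite pole [a], and with [b = f(oo)]
     |f x - f y| = lam |x - y| / (|x - a| |y - a|),
     |f x - b| = lam / |x - a|.
   Hence [f] and its inverse exchange the boundaries, and for [q = f p] the
   Cassinian quotient of [f x], [f y] at [q] is
     |x - y| |p - a| / sqrt (|x - p| |y - p| |x - a| |y - a|).
   If both |x - y| / sqrt (|x - p| |y - p|) and |x - y| / sqrt (|x - a| |y - a|)
   are at most [T], the triangle inequality bounds it by [2 T + T ^ 2], that is,
   by [(1 + T) ^ 2 - 1]; this yields the factor 2 for [f] and, by symmetry, for
   its inverse. The factor 1/2 is approached as [y] tends to the point [x]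
   mapped to the centre of the ball, the factor 2 by points of equal height at
   increasing distance. *)
From HB Require Import structures.
From mathcomp Require Import all_boot.
From Stdlib Require Import Reals Lra FunctionalExtensionality ClassicalEpsilon.
Require Import Defs.
Local Open Scope R_scope.

Set Implicit Arguments.
Unset Strict Implicit.
Unset Printing Implicit Defensive.

(** * Inner product and distance on R^n *)

Fact Rplus_associative : associative Rplus.
Proof. by move=> x y z; rewrite Rplus_assoc. Qed.

(** This makes the big-operator lemmas for commutative monoids, such as [bigD1], available for
    [dot]. *)
HB.instance Definition _ :=
  Monoid.isComLaw.Build R 0 Rplus Rplus_associative Rplus_comm Rplus_0_l.

Section Euclidean.
Variable n : nat.
Implicit Types (x y z p q a b : vec n) (i j : 'I_n).

Lemma dotC x y : dot x y = dot y x.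
Proof. by apply: eq_bigr => i _; apply: Rmult_comm. Qed.

Lemma dot_lin s t x y z :
  dot (fun i => s * x i + t * y i) z = s * dot x z + t * dot y z.
Proof.
rewrite /dot; apply: (big_rec3 (fun u v w => w = s * u + t * v)); first by ring.
by move=> i u v w _ ->; ring.
Qed.

(** Common reduction for the vector identities below: once a difference of points is a combination
    of two vectors, its squared norm is a matter of real algebra. *)
Lemma dot_lin2 s t x y :
  dot (fun i => s * x i + t * y i) (fun i => s * x i + t * y i)
  = s * s * dot x x + 2 * s * t * dot x y + t * t * dot y y.
Proof. by rewrite dot_lin (dotC x) (dotC y) !dot_lin (dotC y x); ring. Qed.

Lemma le_dot x y : (forall i, x i * x i <= y i * y i) -> dot x x <= dot y y.
Proof.
move=> h; rewrite /dot; apply: (big_rec2 (fun u v => u <= v)); first by lra.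
by move=> i u v _ huv; have := h i; lra.
Qed.

Lemma dot_ge0 x : 0 <= dot x x.
Proof.
rewrite /dot; apply: (big_ind (fun u => 0 <= u)); first by lra.
- by move=> u v; lra.
- by move=> i _; nra.
Qed.

Lemma dot_single i x : (forall j, j != i -> x j = 0) -> dot x x = x i * x i.
Proof.
move=> h; rewrite /dot (bigD1 i) //= big1 ?Rplus_0_r // => j ji.
by rewrite h //; ring.
Qed.

Lemma coord_dot x i : x i * x i <= dot x x.
Proof.
rewrite [dot x x](bigD1 i) //=; set S := (X in _ + X).
suff : 0 <= S by lra.
apply: (big_ind (fun u => 0 <= u)); first by lra.
- by move=> u v; lra.
- by move=> j _; nra.
Qed.

Lemma Cauchy_Schwarz x y : dot x y * dot x y <= dot x x * dot y y.
Proof.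
(* The squared norm of |y|^2 x - <x,y> y is |y|^2 (|x|^2 |y|^2 - <x,y>^2); the factor |y|^2 cancels
   when it is positive. *)
have := dot_ge0 (fun i => dot y y * x i + - dot x y * y i).
rewrite dot_lin2 => h; have hx := dot_ge0 x; have hy := dot_ge0 y.
have [y0|y0] : dot y y = 0 \/ 0 < dot y y by lra.
- rewrite y0 {1}/dot big1 => [|i _]; first by lra.
  have := coord_dot y i; rewrite y0 => hi.
  by have -> : y i = 0; nra.
- by apply: (Rmult_le_reg_l (dot y y)) => //; lra.
Qed.

Lemma dist_ge0 x y : 0 <= dist x y.
Proof. exact: sqrt_pos. Qed.

Lemma dist_sqr x y : dist x y * dist x y = dot (vsub x y) (vsub x y).
Proof. by apply: sqrt_sqrt; apply: dot_ge0. Qed.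

Lemma dist_intro x y d :
  0 <= d -> dot (vsub x y) (vsub x y) = d * d -> dist x y = d.
Proof. by move=> d0 h; rewrite /dist /vnorm h sqrt_square. Qed.

Lemma distC x y : dist x y = dist y x.
Proof.
apply: dist_intro; first exact: dist_ge0.
by rewrite dist_sqr; apply: eq_bigr => i _; rewrite /vsub; ring.
Qed.

Lemma coord_dist x y i : Rabs (x i - y i) <= dist x y.
Proof.
apply: Rsqr_incr_0_var; last exact: dist_ge0.
by rewrite -Rsqr_abs /Rsqr dist_sqr; apply: (coord_dot (vsub x y)).
Qed.

Lemma dist_single i x y :
  (forall j, j != i -> x j = y j) -> dist x y = Rabs (x i - y i).
Proof.
move=> h; apply: dist_intro; first exact: Rabs_pos.
rewrite -[RHS]/(Rsqr _) -Rsqr_abs (@dot_single i) // => j /h.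
by rewrite /vsub => ->; ring.
Qed.

Lemma distxx x : dist x x = 0.
Proof.
apply: dist_intro; first by lra.
by rewrite /dot big1; [lra | move=> i _; rewrite /vsub; ring].
Qed.

Lemma dist_eq0 x y : dist x y = 0 -> x = y.
Proof.
move=> h; apply: functional_extensionality => i.
by have := coord_dist x y i; rewrite h; split_Rabs; lra.
Qed.

Lemma dist_gt0 x y : x <> y -> 0 < dist x y.
Proof.
move=> h; have [//|h0] := dist_ge0 x y.
by case: h; apply: dist_eq0.
Qed.

Lemma dist_neq x y : 0 < dist x y -> x <> y.
Proof. by move=> h e; move: h; rewrite e distxx; lra. Qed.

Lemma dist_triangle y x z : dist x z <= dist x y + dist y z.
Proof.
have hxy := dist_ge0 x y; have hyz := dist_ge0 y z.
apply: Rsqr_incr_0_var; last by lra.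
rewrite /Rsqr dist_sqr.
have -> : vsub x z = fun i => 1 * vsub x y i + 1 * vsub y z i.
  by apply: functional_extensionality => i; rewrite /vsub; ring.
rewrite dot_lin2 -!dist_sqr.
have : dot (vsub x y) (vsub y z) <= dist x y * dist y z.
  apply: Rsqr_incr_0_var; last by nra.
  have := Cauchy_Schwarz (vsub x y) (vsub y z).
  by rewrite -!dist_sqr /Rsqr; lra.
by lra.
Qed.

Definition set_coord x i (s : R) : vec n := fun j => if j == i then s else x j.

Lemma set_coordE x i s : set_coord x i s i = s.
Proof. by rewrite /set_coord eqxx. Qed.

Lemma set_coord_neq x i s j : j != i -> set_coord x i s j = x j.
Proof. by rewrite /set_coord => /negbTE ->. Qed.

Lemma dist_set_coord x i s : dist (set_coord x i s) x = Rabs (s - x i).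
Proof.
by rewrite (@dist_single i) => [|j ji]; rewrite ?set_coordE ?set_coord_neq.
Qed.

Definition origin : vec n := fun=> 0.

Lemma vnorm_dist x : vnorm x = dist origin x.
Proof.
rewrite distC; congr vnorm.
by apply: functional_extensionality => i; rewrite /vsub /origin; ring.
Qed.

Definition scale (s : R) x : vec n := fun i => s * x i.

Lemma scale0 x : scale 0 x = origin.
Proof. by apply: functional_extensionality => i; rewrite /scale Rmult_0_l. Qed.

Lemma scale1 x : scale 1 x = x.
Proof. by apply: functional_extensionality => i; rewrite /scale Rmult_1_l. Qed.

Lemma dist_scale s t x : dist (scale s x) (scale t x) = Rabs (s - t) * vnorm x.
Proof.
apply: dist_intro; first by apply: Rmult_le_pos; [exact: Rabs_pos | exact: sqrt_pos].
have -> : vsub (scale s x) (scale t x) = fun i => (s - t) * x i + 0 * x i.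
  by apply: functional_extensionality => i; rewrite /vsub /scale; ring.
have := Rsqr_abs (s - t); rewrite /Rsqr => e.
transitivity ((s - t) * (s - t) * dot x x); first by rewrite dot_lin2; ring.
by rewrite e -(sqrt_sqrt _ (dot_ge0 x)) -/(vnorm x); ring.
Qed.

Lemma vnorm_scale s x : vnorm (scale s x) = Rabs s * vnorm x.
Proof.
by rewrite vnorm_dist -(scale0 x) dist_scale Rminus_0_l Rabs_Ropp.
Qed.

(** A boundary point closer than [d] to [x] would have a whole neighbourhood inside [D], hence no
    nearby point of the complement. *)
Lemma boundary_far (D : vec n -> Prop) x p d :
  (forall q, dist q x < d -> D q) -> boundary D p -> d <= dist x p.
Proof.
move=> hD hp; apply: Rnot_lt_le => hlt.
have [|_ [q [hq hqp]]] := hp (d - dist x p); first by lra.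
by apply: hq; apply: hD; have := dist_triangle p q x; rewrite (distC p); lra.
Qed.

(* This quantity is multiplied by a product of one-point weights under
   every Möbius transformation, including at [∞]. *)
Definition edist (X Y : point n) : R :=
  match X, Y with
  | Some x, Some y => dist x y
  | None, None => 0
  | _, _ => 1
  end.

Lemma edistC X Y : edist X Y = edist Y X.
Proof. by case: X Y => [x|] [y|] //=; apply: distC. Qed.

(** * Reflections in hyperplanes and inversions in spheres *)

Lemma dot_gt0 a : (exists i, a i <> 0) -> 0 < dot a a.
Proof. by case=> i ai; have := coord_dot a i; nra. Qed.

Lemma refl_planeK a t : (exists i, a i <> 0) -> involutive (@refl_plane n a t).
Proof.
move=> /dot_gt0 ha [x|] //=; congr Some; apply: functional_extensionality => i.
set k := 2 * (dot x a - t) / dot a a.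
have -> : (fun i => x i - k * a i) = fun i => 1 * x i + - k * a i.
  by apply: functional_extensionality => j; ring.
by rewrite dot_lin /k; field; lra.
Qed.

(** The offset [t] cancels in the difference of the images, which is the linear reflection of
    [x - y] and so has the same norm. *)
Lemma edist_refl_plane a t X Y : (exists i, a i <> 0) ->
  edist (refl_plane a t X) (refl_plane a t Y) = edist X Y.
Proof.
move=> /dot_gt0 ha; case: X Y => [x|] [y|] //=.
apply: dist_intro; first exact: dist_ge0.
rewrite dist_sqr.
have -> : vsub (fun i => x i - 2 * (dot x a - t) / dot a a * a i)
    (fun i => y i - 2 * (dot y a - t) / dot a a * a i)
  = fun i => 1 * vsub x y i + - (2 * dot (vsub x y) a / dot a a) * a i.
  have -> : dot (vsub x y) a = 1 * dot x a + -1 * dot y a.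
    rewrite -dot_lin; congr dot.
    by apply: functional_extensionality => i; rewrite /vsub; ring.
  by apply: functional_extensionality => i; rewrite /vsub; field; lra.
by rewrite dot_lin2; field; lra.
Qed.

Definition inversion a (r : R) x : vec n :=
  fun i => a i + r ^ 2 * (x i - a i) / dot (vsub x a) (vsub x a).

Lemma refl_sphere_center a r : refl_sphere a r (Some a) = None.
Proof. by rewrite /refl_sphere; case: excluded_middle_informative. Qed.

Lemma refl_sphere_neq a r x :
  x <> a -> refl_sphere a r (Some x) = Some (inversion a r x).
Proof. by rewrite /refl_sphere; case: excluded_middle_informative. Qed.

Lemma dist_inversion a r x y : 0 < r -> x <> a -> y <> a ->
  dist (inversion a r x) (inversion a r y)
  = r / dist x a * (r / dist y a) * dist x y.
Proof.
move=> r0 xa ya; have hx := dist_gt0 xa; have hy := dist_gt0 ya.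
have hxy := dist_ge0 x y.
apply: dist_intro.
  apply: Rmult_le_pos => //; apply: Rlt_le.
  by apply: Rmult_lt_0_compat; apply: Rdiv_lt_0_compat.
rewrite /inversion -(dist_sqr x a) -(dist_sqr y a).
set d1 := dist x a in hx *; set d2 := dist y a in hy *.
have -> : vsub (fun i => a i + r ^ 2 * (x i - a i) / (d1 * d1))
               (fun i => a i + r ^ 2 * (y i - a i) / (d2 * d2))
   = fun i => r ^ 2 / (d1 * d1) * vsub x a i + - (r ^ 2 / (d2 * d2)) * vsub y a i.
  by apply: functional_extensionality => i; rewrite /vsub; field; lra.
rewrite dot_lin2 -!dist_sqr -/d1 -/d2.
(* Polarization expresses the inner product by the three distances, so that only an identity between
   real numbers remains. *)
have -> : dot (vsub x a) (vsub y a) = (d1 * d1 + d2 * d2 - dist x y * dist x y) / 2.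
  rewrite /d1 /d2 !dist_sqr.
  have -> : vsub x y = fun i => 1 * vsub x a i + -1 * vsub y a i.
    by apply: functional_extensionality => i; rewrite /vsub; ring.
  by rewrite dot_lin2; field.
by field; lra.
Qed.

Lemma dist_inversion_center a r x : 0 < r -> x <> a ->
  dist (inversion a r x) a = r / dist x a * r.
Proof.
move=> r0 xa; have hx := dist_gt0 xa.
apply: dist_intro.
  by apply: Rlt_le; apply: Rmult_lt_0_compat => //; apply: Rdiv_lt_0_compat.
rewrite /inversion -(dist_sqr x a); set d := dist x a in hx *.
have -> : vsub (fun i => a i + r ^ 2 * (x i - a i) / (d * d)) a
   = fun i => r ^ 2 / (d * d) * vsub x a i + 0 * vsub x a i.
  by apply: functional_extensionality => i; rewrite /vsub; field; lra.
by rewrite dot_lin2 -!dist_sqr -/d; field; lra.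
Qed.

Lemma refl_sphereK a r : 0 < r -> involutive (@refl_sphere n a r).
Proof.
move=> r0 [x|]; last exact: refl_sphere_center.
case: (excluded_middle_informative (x = a)) => [->|xa].
  by rewrite refl_sphere_center.
have d0 := dist_gt0 xa.
have ya : inversion a r x <> a.
  apply: dist_neq; rewrite dist_inversion_center //.
  by apply: Rmult_lt_0_compat => //; apply: Rdiv_lt_0_compat.
rewrite !refl_sphere_neq //; congr Some; apply: functional_extensionality => i.
rewrite {1}/inversion -dist_sqr dist_inversion_center // /inversion -dist_sqr.
by field; lra.
Qed.

Lemma edist_refl_sphere a r : 0 < r -> exists mu : point n -> R,
  (forall X, 0 < mu X) /\
  forall X Y, edist (refl_sphere a r X) (refl_sphere a r Y) = mu X * mu Y * edist X Y.
Proof.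
move=> r0.
(* The usual weight is r / |x - a|. The values 1 / r at the centre and r at ∞ are forced by the
   convention that ∞ has distance 1 from every finite point. *)
pose mu (X : point n) := if X is Some x then
   if excluded_middle_informative (x = a) then / r else r / dist x a else r.
have mu_center : mu (Some a) = / r.
  by rewrite /mu; case: excluded_middle_informative.
have mu_neq x : x <> a -> mu (Some x) = r / dist x a.
  by rewrite /mu; case: excluded_middle_informative.
exists mu; split=> [[x|] //|].
  case: (excluded_middle_informative (x = a)) => [->|xa].
    by rewrite mu_center; apply: Rinv_0_lt_compat.
  by rewrite mu_neq //; apply: Rdiv_lt_0_compat => //; apply: dist_gt0.
have hc x : x <> a ->
    edist (refl_sphere a r (Some x)) None = mu (Some x) * mu (Some a) * dist x a.
  move=> xa; rewrite mu_center mu_neq // refl_sphere_neq //=.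
  by have := dist_gt0 xa => h; field; lra.
have hi x : edist (refl_sphere a r (Some x)) (Some a) = mu (Some x) * mu None.
  case: (excluded_middle_informative (x = a)) => [->|xa].
    by rewrite mu_center refl_sphere_center /=; field; lra.
  by rewrite mu_neq // refl_sphere_neq //=; apply: dist_inversion_center.
case=> [x|] [y|].
- case: (excluded_middle_informative (x = a)) => [->|xa];
  case: (excluded_middle_informative (y = a)) => [->|ya].
  + by rewrite refl_sphere_center /= distxx; ring.
  + by rewrite edistC refl_sphere_center hc //= (distC a); ring.
  + by rewrite refl_sphere_center hc.
  + by rewrite !refl_sphere_neq // !mu_neq // [LHS]dist_inversion.
- by rewrite hi /= Rmult_1_r.
- by rewrite edistC hi /= Rmult_1_r Rmult_comm.
- by rewrite /= distxx Rmult_0_r.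
Qed.

(** Bijections that scale [edist] by one-point weights are closed under composition: the weight of
    the outer map, evaluated at [f X], multiplies that of [f]. *)
Lemma mobius_edist (f : point n -> point n) : mobius f ->
  exists (g : point n -> point n) (mu : point n -> R),
    [/\ cancel f g, cancel g f, forall X, 0 < mu X &
        forall X Y, edist (f X) (f Y) = mu X * mu Y * edist X Y].
Proof.
elim=> [|a t {}f ha _ [g [mu [fK gK mu0 hmu]]]|a r {}f hr _ [g [mu [fK gK mu0 hmu]]]].
- by exists (fun X => X), (fun=> 1); split=> // *; lra.
- exists (g \o refl_plane a t), mu; split=> //.
  + by move=> X /=; rewrite refl_planeK.
  + by move=> X /=; rewrite gK refl_planeK.
  + by move=> X Y; rewrite edist_refl_plane.
- have [nu [nu0 hnu]] := edist_refl_sphere a hr.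
  exists (g \o refl_sphere a r), (fun X => nu (f X) * mu X); split=> //.
  + by move=> X /=; rewrite refl_sphereK.
  + by move=> X /=; rewrite gK refl_sphereK.
  + by move=> X; apply: Rmult_lt_0_compat.
  + by move=> X Y; rewrite hnu hmu; ring.
Qed.

End Euclidean.

(** * Bijections of R^n ∪ {∞} with a finite pole *)

Section PoleInversion.
Variable n : nat.
Implicit Types (x y z p q a b : vec n) (phi psi : vec n -> vec n).

(* [phi] is the finite part of a Möbius map sending [a] to [∞] and [∞] to [b],
   and [psi] that of its inverse. *)
Definition pole_inversion a b (lam : R) phi psi : Prop :=
  [/\ forall x, x <> a -> phi x <> b /\ psi (phi x) = x,
      forall z, z <> b -> psi z <> a /\ phi (psi z) = z,
      forall x y, x <> a -> y <> a ->
        dist (phi x) (phi y) * (dist x a * dist y a) = lam * dist x y &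
      forall x, x <> a -> dist (phi x) b * dist x a = lam].

(** The inverse has the same form with [a] and [b] exchanged, so every transport result for [phi]
    also applies to [psi]. The distance formula follows by eliminating A C = B D = [lam], the pole
    formula at the two points. *)
Lemma pole_inversion_sym a b lam phi psi :
  pole_inversion a b lam phi psi -> pole_inversion b a lam psi phi.
Proof.
case=> hphi hpsi hd hb.
have hb' z : z <> b -> dist (psi z) a * dist z b = lam.
  by move=> zb; have [ya e] := hpsi z zb; rewrite -(hb _ ya) e Rmult_comm.
split=> // z w zb wb.
have [xa ez] := hpsi z zb; have [ya ew] := hpsi w wb.
have := hd _ _ xa ya; rewrite ez ew.
have := hb' z zb; have := hb' w wb.
have := dist_gt0 zb; have := dist_gt0 wb; have := dist_gt0 xa; have := dist_gt0 ya.
move: (dist (psi z) a) (dist (psi w) a) (dist z b) (dist w b) (dist z w)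
  (dist (psi z) (psi w)) => A B C D E F hB hA hD hC e1 e2 e3.
have l0 : lam <> 0 by nra.
apply: (Rmult_eq_reg_l lam) => //.
transitivity (lam * F * (C * D)); first by ring.
by rewrite -e3 -{1}e1 -e2; ring_simplify; nra.
Qed.

Section Transport.
Variables (a b : vec n) (lam : R) (phi psi : vec n -> vec n).
Hypothesis lam_gt0 : 0 < lam.
Hypothesis inv : pole_inversion a b lam phi psi.

Lemma boundary_transport (D E : vec n -> Prop) p :
  (forall x, x <> a -> (D x <-> E (phi x))) -> p <> a ->
  boundary D p -> boundary E (phi p).
Proof.
move=> hDE pa hp eps eps0.
have [_ _ hd _] := inv.
have m0 := dist_gt0 pa; set m := dist p a in m0.
have hm : 0 < m / 2 by lra.
have hl : 0 < eps * (m * m) / (2 * lam).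
  by apply: Rdiv_lt_0_compat; [apply: Rmult_lt_0_compat; nra | lra].
(* Within m / 2 of [p] the distance to [a] exceeds m / 2, so [phi] expands the distance to [p] by a
   factor below 2 [lam] / m^2; this dictates the second radius. *)
have hclose q : dist q p < Rmin (m / 2) (eps * (m * m) / (2 * lam)) ->
    q <> a /\ dist (phi q) (phi p) < eps.
  move=> hq; have h1 := Rlt_le_trans _ _ _ hq (Rmin_l _ _).
  have h2 := Rlt_le_trans _ _ _ hq (Rmin_r _ _).
  have hqa : m / 2 < dist q a.
    by have := dist_triangle q p a; rewrite (distC p q) -/m; lra.
  have qa : q <> a by apply: dist_neq; lra.
  split=> //.
  have e := hd _ _ qa pa; rewrite -/m in e.
  have h3 : lam * dist q p < eps * (m / 2 * m).
    have -> : eps * (m / 2 * m) = lam * (eps * (m * m) / (2 * lam)) by field; lra.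
    exact: Rmult_lt_compat_l.
  have h4 : m / 2 * m < dist q a * m by apply: Rmult_lt_compat_r.
  apply: Rnot_le_lt => h5.
  have : eps * (m / 2 * m) <= dist (phi q) (phi p) * (dist q a * m).
    by apply: Rmult_le_compat; lra || nra.
  lra.
have [[q [Dq hq]] [q' [Dq' hq']]] := hp _ (Rmin_pos _ _ hm hl).
have [qa hq2] := hclose q hq; have [qa' hq2'] := hclose q' hq'.
split; [exists (phi q) | exists (phi q')]; split=> //; first exact/hDE.
by move=> /(hDE _ qa').
Qed.

(** Far points land near [b], since |phi x - b| = [lam] / |x - a|; a set and its complement that are
    both unbounded therefore both accumulate at [b] after mapping. *)
Lemma boundary_pole_image (D E : vec n -> Prop) :
  (forall x, x <> a -> (D x <-> E (phi x))) ->
  (forall M, exists x, D x /\ M < dist x a) ->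
  (forall M, exists x, ~ D x /\ M < dist x a) ->
  boundary E b.
Proof.
move=> hDE far far' eps eps0.
have [_ _ _ hb] := inv.
have l0 : 0 < lam / eps by apply: Rdiv_lt_0_compat.
have hclose x : lam / eps < dist x a -> x <> a /\ dist (phi x) b < eps.
  move=> hx; have xa : x <> a by apply: dist_neq; lra.
  split=> //; have e := hb x xa.
  apply: Rnot_le_lt => h.
  have : lam < eps * dist x a.
    have {1}-> : lam = eps * (lam / eps) by field; lra.
    exact: Rmult_lt_compat_l.
  have : eps * dist x a <= dist (phi x) b * dist x a.
    by apply: Rmult_le_compat_r => //; apply: dist_ge0.
  lra.
have [x [Dx /hclose [xa hx]]] := far (lam / eps).
have [y [Dy /hclose [ya hy]]] := far' (lam / eps).
split; [exists (phi x) | exists (phi y)]; split=> //; first exact/hDE.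
by move=> /(hDE _ ya).
Qed.

(** The weights of [x] and [y] enter the numerator fully and the denominator only under a square
    root, so one factor sqrt (|x - a| |y - a|) survives, while the weight of [p] moves |p - a| to
    the other side. *)
Lemma pole_inversion_ratio K x y p : x <> a -> y <> a -> p <> a ->
  dist (phi x) (phi y) <= K * sqrt (dist (phi x) (phi p) * dist (phi y) (phi p)) <->
  dist x y * dist p a <= K * (sqrt (dist x p * dist y p) * sqrt (dist x a * dist y a)).
Proof.
move=> xa ya pa; have [_ _ hd _] := inv.
have := hd _ _ xa ya; have := hd _ _ xa pa; have := hd _ _ ya pa.
have := dist_gt0 xa; have := dist_gt0 ya; have := dist_gt0 pa.
have := dist_ge0 x p; have := dist_ge0 y p.
set A := dist x a; set B := dist y a; set M := dist p a.
set P := dist x p; set Q := dist y p => Q0 P0 M0 B0 A0 eQ eP ed.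
have hAB : 0 < A * B by apply: Rmult_lt_0_compat.
have s0 := sqrt_lt_R0 _ hAB; have ss := sqrt_sqrt _ (Rlt_le _ _ hAB).
have -> : dist (phi x) (phi p) * dist (phi y) (phi p)
    = (lam / M * (lam / M)) * (P * Q) / (A * B).
  have -> : dist (phi x) (phi p) = lam * P / (A * M) by rewrite -eP; field; lra.
  have -> : dist (phi y) (phi p) = lam * Q / (B * M) by rewrite -eQ; field; lra.
  by field; lra.
have hPQ : 0 <= P * Q by nra.
have lM : 0 < lam / M by apply: Rdiv_lt_0_compat.
rewrite sqrt_div_alt // sqrt_mult_alt; last by nra.
rewrite sqrt_square; last by lra.
have -> : dist (phi x) (phi y) = lam / M * (dist x y * M / (A * B)).
  by transitivity (lam * dist x y / (A * B)); [rewrite -ed; field | field]; lra.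
set s := sqrt (A * B) in s0 ss *; rewrite -ss.
have -> : lam / M * (dist x y * M / (s * s)) = lam / M / (s * s) * (dist x y * M).
  by field; lra.
have -> : K * (lam / M * sqrt (P * Q) / s) = lam / M / (s * s) * (K * (sqrt (P * Q) * s)).
  by field; lra.
have c0 : 0 < lam / M / (s * s) by apply: Rdiv_lt_0_compat => //; nra.
by split=> h; [apply: (Rmult_le_reg_l _ _ _ c0) | apply: Rmult_le_compat_l; lra].
Qed.

(** The counterpart at [b], the image of ∞: the Cassinian quotient there is the quotient of [x], [y]
    at the pole [a]. *)
Lemma pole_inversion_ratio_pole K x y : x <> a -> y <> a ->
  dist (phi x) (phi y) <= K * sqrt (dist (phi x) b * dist (phi y) b) <->
  dist x y <= K * sqrt (dist x a * dist y a).
Proof.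
move=> xa ya; have [_ _ hd hb] := inv.
have := hd _ _ xa ya; have := hb _ xa; have := hb _ ya.
have := dist_gt0 xa; have := dist_gt0 ya.
set A := dist x a; set B := dist y a => B0 A0 eB eA ed.
have hAB : 0 < A * B by apply: Rmult_lt_0_compat.
have s0 := sqrt_lt_R0 _ hAB; have ss := sqrt_sqrt _ (Rlt_le _ _ hAB).
have -> : dist (phi x) b * dist (phi y) b = lam * lam / (A * B).
  by rewrite -{1}eA -eB; field; lra.
rewrite sqrt_div_alt // sqrt_square; last by lra.
have -> : dist (phi x) (phi y) = lam * dist x y / (A * B) by rewrite -ed; field; lra.
set s := sqrt (A * B) in s0 ss *; rewrite -ss.
have -> : lam * dist x y / (s * s) = lam / (s * s) * dist x y by field; lra.
have -> : K * (lam / s) = lam / (s * s) * (K * s) by field; lra.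
have c0 : 0 < lam / (s * s) by apply: Rdiv_lt_0_compat => //; nra.
by split=> h; [apply: (Rmult_le_reg_l _ _ _ c0) | apply: Rmult_le_compat_l; lra].
Qed.

End Transport.

Lemma min_le_sqrt u v : 0 <= u -> 0 <= v -> Rmin u v <= sqrt (u * v).
Proof.
move=> u0 v0; rewrite -{1}(sqrt_square (Rmin u v)); last exact: Rmin_glb.
apply: sqrt_le_1_alt; apply: Rmult_le_compat; try exact: Rmin_glb;
  [exact: Rmin_l | exact: Rmin_r].
Qed.

(* The path from [p] to [a] through the closer of [x], [y] to each endpoint
   has length at most [min (P, Q) + d + min (A, B)]. *)
Lemma cassinian_quad T x y p a : 0 <= T ->
  dist x y <= T * sqrt (dist x p * dist y p) ->
  dist x y <= T * sqrt (dist x a * dist y a) ->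
  dist x y * dist p a <=
    (2 * T + T * T) * (sqrt (dist x p * dist y p) * sqrt (dist x a * dist y a)).
Proof.
move=> T0 h1 h2.
have hm1 := min_le_sqrt (dist_ge0 x p) (dist_ge0 y p).
have hm2 := min_le_sqrt (dist_ge0 x a) (dist_ge0 y a).
have t1 := dist_triangle x p a; have t2 := dist_triangle y p a.
have t3 := dist_triangle y x a; have t4 := dist_triangle x y a.
rewrite !(distC p) (distC y x) in t1 t2 t3 t4.
have d0 := dist_ge0 x y.
have s1 := sqrt_pos (dist x p * dist y p); have s2 := sqrt_pos (dist x a * dist y a).
set al := sqrt (dist x p * _) in h1 hm1 s1 *.
set be := sqrt (dist x a * _) in h2 hm2 s2 *.
have hM : dist p a <= al + be + dist x y.
  rewrite (distC p); move: hm1 hm2; rewrite /Rmin.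
  by case: Rle_dec => _; case: Rle_dec => _ *; lra.
(* In [dist x y * al] the distance is bounded through [be], and conversely, so that each of the
   three summands becomes a multiple of [al * be]. *)
have := Rmult_le_compat_l _ _ _ d0 hM.
have : dist x y * al <= T * be * al by apply: Rmult_le_compat_r.
have : dist x y * be <= T * al * be by apply: Rmult_le_compat_r.
have : dist x y * dist x y <= (T * al) * (T * be) by apply: Rmult_le_compat.
lra.
Qed.

(** A boundary point [q] other than [b] is the image of the boundary point [psi q], where
    [cassinian_quad] applies; at [b] the bound at the pole suffices, as T <= 2 T + T^2. General [D]
    and [E] allow use in both directions. *)
Lemma cassinian_transport a b lam phi psi (D E : vec n -> Prop) T x y q :
  0 < lam -> pole_inversion a b lam phi psi ->
  (forall q, q <> b -> boundary E q -> boundary D (psi q)) ->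
  x <> a -> y <> a -> 0 <= T ->
  (forall p, boundary D p -> dist x y <= T * sqrt (dist x p * dist y p)) ->
  dist x y <= T * sqrt (dist x a * dist y a) ->
  boundary E q ->
  dist (phi x) (phi y) <= (2 * T + T * T) * sqrt (dist (phi x) q * dist (phi y) q).
Proof.
move=> l0 inv hE xa ya T0 hT ha hq.
case: (excluded_middle_informative (q = b)) => [->|qb].
  apply/(pole_inversion_ratio_pole l0 inv) => //.
  apply: Rle_trans ha _; apply: Rmult_le_compat_r; first exact: sqrt_pos.
  by nra.
have [_ hpsi _ _] := inv; have [pa eq] := hpsi q qb.
rewrite -{}eq; apply/(pole_inversion_ratio l0 inv) => //.
by apply: cassinian_quad => //; apply: hT; apply: hE.
Qed.

End PoleInversion.

(** * The supremum defining the metric *)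

Lemma Rsup_is_lub (E : R -> Prop) : bound E -> (exists v, E v) -> is_lub E (Rsup E).
Proof.
move=> hb hne; rewrite /Rsup; case: excluded_middle_informative => [h|h].
  by case: constructive_indefinite_description.
by case: h; have [m hm] := completeness E hb hne; exists m.
Qed.

(* [T] is the supremum in the definition of the metric; the inequalities are
   written without division so that they can be transported. *)
Definition cassinian_sup n (D : vec n -> Prop) (x y : vec n) (T : R) : Prop :=
  [/\ 0 <= T, cassinian_tilde D x y = ln (1 + T),
      forall p, boundary D p -> dist x y <= T * sqrt (dist x p * dist y p) &
      forall K, (forall p, boundary D p -> dist x y <= K * sqrt (dist x p * dist y p)) ->
        T <= K].

(** A positive distance [d] to the boundary bounds all quotients by |x - y| / d, and a boundary
    point makes the set nonempty; together they exclude the default value of [Rsup]. *)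
Lemma cassinian_supP n (D : vec n -> Prop) (x y : vec n) d :
  0 < d -> (forall p, boundary D p -> d <= dist x p /\ d <= dist y p) ->
  (exists p, boundary D p) -> exists T, cassinian_sup D x y T.
Proof.
move=> d0 hd [p0 hp0].
have hs p : boundary D p -> d <= sqrt (dist x p * dist y p).
  move=> /hd [h1 h2]; rewrite -{1}(sqrt_square d); last by lra.
  by apply: sqrt_le_1_alt; apply: Rmult_le_compat; lra.
set F := fun v => exists p, boundary D p /\ v = dist x y / sqrt (dist x p * dist y p).
have hdiv K p : boundary D p -> dist x y <= K * sqrt (dist x p * dist y p) <->
    dist x y / sqrt (dist x p * dist y p) <= K.
  move=> /hs; set s := sqrt _ => hsp; have s0 : 0 < s by lra.
  have e : dist x y = dist x y / s * s by field; lra.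
  split=> h; last by rewrite e; apply: Rmult_le_compat_r; lra.
  by apply: (Rmult_le_reg_r s) => //; rewrite -e.
have [hub hleast] : is_lub F (Rsup F).
  apply: Rsup_is_lub; last by exists (dist x y / sqrt (dist x p0 * dist y p0)), p0.
  exists (dist x y / d) => v [p [hp ->]]; apply/hdiv => //.
  have {1}-> : dist x y = dist x y / d * d by field; lra.
  apply: Rmult_le_compat_l; last exact: hs.
  by apply: Rmult_le_pos; [exact: dist_ge0 | apply: Rlt_le; apply: Rinv_0_lt_compat].
have hT p : boundary D p -> dist x y <= Rsup F * sqrt (dist x p * dist y p).
  by move=> hp; apply/hdiv => //; apply: hub; exists p.
exists (Rsup F); split=> //.
- have := hT _ hp0; have := hs _ hp0; have := dist_ge0 x y.
  set s := sqrt _ => h1 h2 h3; apply: Rnot_lt_le => h4.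
  have s0 : 0 < s by lra.
  have : 0 < - Rsup F * s by apply: Rmult_lt_0_compat; lra.
  by lra.
- by move=> K hK; apply: hleast => v [p [hp ->]]; apply/hdiv => //; apply: hK.
Qed.

Lemma cassinian_sup_gt0 n (D : vec n -> Prop) (x y : vec n) T :
  cassinian_sup D x y T -> (exists p, boundary D p) -> x <> y -> 0 < T.
Proof.
case=> T0 _ h _ [p hp] /dist_gt0 xy; have := h p hp.
by have := sqrt_pos (dist x p * dist y p); nra.
Qed.

(** * The half-space and the ball *)

Section Ball.
Variable n : nat.
Implicit Types (z w q : vec n).

Lemma vnorm_origin : vnorm (@origin n) = 0.
Proof. by rewrite vnorm_dist distxx. Qed.

Lemma unit_ball_dist z q :
  boundary (@unit_ball n) q -> 1 - vnorm z <= dist z q.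
Proof.
apply: boundary_far => w; rewrite /unit_ball !vnorm_dist (distC w).
by have := dist_triangle z (@origin n) w; lra.
Qed.

Lemma boundary_unit_ball q : boundary (@unit_ball n) q <-> vnorm q = 1.
Proof.
split=> [hq|hq].
  apply: Rle_antisym; last first.
    by have := unit_ball_dist (@origin n) hq; rewrite vnorm_origin -vnorm_dist; lra.
  apply: Rnot_lt_le => h1; have [|[w [Bw hw]] _] := hq (vnorm q - 1); first by lra.
  move: Bw hw; rewrite /unit_ball !vnorm_dist.
  by have := dist_triangle w (@origin n) q; lra.
(* Inside the ball, [q] is approached radially by (1 - s) q; outside, [q] itself serves because the
   ball is open. *)
move=> eps eps0; set s := Rmin (eps / 2) 1.
have s1 : s <= eps / 2 := Rmin_l _ _; have s2 : s <= 1 := Rmin_r _ _.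
have s0 : 0 < s by apply: Rmin_pos; lra.
split; [exists (scale (1 - s) q) | exists q]; rewrite /unit_ball; last first.
  by rewrite distxx hq; lra.
rewrite vnorm_scale hq -{2}(scale1 q) dist_scale hq.
by split; split_Rabs; lra.
Qed.

End Ball.

Section HalfSpace.
Variables (n : nat) (il : 'I_n).
Hypothesis il_last : nat_of_ord il = n.-1.
Implicit Types (x p : vec n).

Lemma upper_halfE x : upper_half x <-> 0 < x il.
Proof.
split=> [/(_ il il_last) //|h i hi].
by have -> : i = il by apply: ord_inj; rewrite il_last.
Qed.

Lemma boundary_upper_half p : p il = 0 -> boundary (@upper_half n) p.
Proof.
move=> hp eps eps0; split; [exists (set_coord p il (eps / 2)) | exists p].
  split; first by apply/upper_halfE; rewrite set_coordE; lra.
  by rewrite dist_set_coord hp; split_Rabs; lra.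
by split; [move/upper_halfE; lra | rewrite distxx].
Qed.

Lemma upper_half_dist x p : boundary (@upper_half n) p -> x il <= dist x p.
Proof.
apply: boundary_far => q hq; apply/upper_halfE.
by have := coord_dist q x il; split_Rabs; lra.
Qed.

(** Lets a bound at a boundary point replace a bound at the pole, which lies below the
    half-space. *)
Lemma dist_foot x a : 0 <= x il -> a il <= 0 -> dist x (set_coord a il 0) <= dist x a.
Proof.
move=> hx ha; apply: sqrt_le_1_alt; apply: le_dot => i; rewrite /vsub.
case: (eqVneq i il) => [->|ne]; last by rewrite set_coord_neq //; lra.
by rewrite set_coordE; nra.
Qed.

Record half_ball_map (f : point n -> point n) (a b : vec n) (lam : R)
    (phi psi : vec n -> vec n) : Prop := {
  hbm_lam : 0 < lam;
  hbm_inv : pole_inversion a b lam phi psi;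
  hbm_finite : forall x, x <> a -> f (Some x) = Some (phi x);
  hbm_pole : a il < 0;
  hbm_image : boundary (@unit_ball n) b;
  hbm_iff : forall x, x <> a -> (upper_half x <-> unit_ball (phi x));
  hbm_boundary : forall p, p <> a ->
    boundary (@upper_half n) p -> boundary (@unit_ball n) (phi p);
  hbm_boundary_inv : forall q, q <> b ->
    boundary (@unit_ball n) q -> boundary (@upper_half n) (psi q)
}.

Lemma mobius_half_ball_map (i0 : 'I_n) (f : point n -> point n) : i0 != il ->
  mobius f ->
  (forall x, upper_half x -> exists z, f (Some x) = Some z /\ unit_ball z) ->
  (forall z, unit_ball z -> exists x, upper_half x /\ f (Some x) = Some z) ->
  exists a b lam phi psi, half_ball_map f a b lam phi psi.
Proof.
move=> i0l /mobius_edist [g [mu [fK gK mu0 hmu]]] hHB hBH.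
case fN : (f None) => [b|]; last first.
  (* If f(∞) = ∞, then [f] is a similarity of ratio 1 / [mu None]^2. The points [x0] and [x], at
     equal height and at distance 2 [mu None]^2, go to points at distance 2, too far apart for the
     open unit ball. *)
  pose x0 : vec n := fun=> 1.
  pose x := set_coord x0 i0 (1 + 2 * (mu None * mu None)).
  have [|z0 [fx0]] := hHB x0; first by apply/upper_halfE; rewrite /x0; lra.
  have [|z [fx]] := hHB x.
    by apply/upper_halfE; rewrite /x set_coord_neq /x0 1?eq_sym //; lra.
  rewrite /unit_ball !vnorm_dist.
  have := dist_triangle (@origin n) z z0; rewrite (distC z (@origin n)).
  have := hmu (Some x0) None; have := hmu (Some x) None.
  have := hmu (Some x) (Some x0); rewrite fx fx0 fN /= dist_set_coord /x0.
  have m0 := mu0 None; have mm0 : 0 < mu None * mu None by nra.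
  have -> : Rabs (1 + 2 * (mu None * mu None) - 1) = 2 * (mu None * mu None).
    by split_Rabs; lra.
  move: (mu (Some x)) (mu (Some (fun=> 1))) => u v e0 e1 e2.
  have : dist z z0 = 2 * ((u * mu None) * (v * mu None)) by rewrite e0; ring.
  have -> : u * mu None = 1 by lra.
  have -> : v * mu None = 1 by lra.
  by lra.
case gN : (g None) => [a|]; last by have := gK None; rewrite gN fN.
have fa : f (Some a) = None by rewrite -gN gK.
have gb : g (Some b) = None by rewrite -fN fK.
(* The defaults are taken only at the poles [x = a] and [z = b]. *)
pose phi x := odflt b (f (Some x)); pose psi z := odflt a (g (Some z)).
have fE x : x <> a -> f (Some x) = Some (phi x).
  move=> xa; rewrite /phi; case e : (f (Some x)) => [//|].
  by case: xa; have := fK (Some x); rewrite e gN => -[].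
have gE z : z <> b -> g (Some z) = Some (psi z).
  move=> zb; rewrite /psi; case e : (g (Some z)) => [//|].
  by case: zb; have := gK (Some z); rewrite e fN => -[].
(* Comparing [x] with [a] and [a] with ∞ gives [mu (Some x)] = [mu None] / |x - a|, whence this
   value of [lam]. *)
pose lam := mu None * mu None.
have mN := mu0 None; have ma := mu0 (Some a).
have lam0 : 0 < lam by apply: Rmult_lt_0_compat.
have eaN : mu (Some a) * mu None = 1.
  by have := hmu (Some a) None; rewrite fa fN /=; lra.
have hmux x : x <> a -> mu (Some x) * dist x a = mu None.
  move=> xa; have := hmu (Some x) (Some a); rewrite fE // fa /= => e.
  transitivity (mu (Some x) * dist x a * (mu (Some a) * mu None)).
    by rewrite eaN Rmult_1_r.
  by rewrite -[RHS]Rmult_1_l e; ring.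
have inv : pole_inversion a b lam phi psi.
  split.
  - move=> x xa; have e := fE x xa; split.
      by move=> h; have := fK (Some x); rewrite e h gb.
    by rewrite /psi -e fK.
  - move=> z zb; have e := gE z zb; split.
      by move=> h; have := gK (Some z); rewrite e h fa.
    by rewrite /phi -e gK.
  - move=> x y xa ya; have := hmu (Some x) (Some y); rewrite !fE //= => ->.
    by rewrite /lam -{1}(hmux x xa) -(hmux y ya); ring.
  - move=> x xa; have := hmu (Some x) None; rewrite fE // fN /= => ->.
    by rewrite /lam -{2}(hmux x xa); ring.
have Hnota : ~ upper_half a by move/hHB => [z []]; rewrite fa.
have hiff x : x <> a -> (upper_half x <-> unit_ball (phi x)).
  move=> xa; split=> [/hHB [z []]|/hBH [y [Hy]]]; first by rewrite fE // => -[->].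
  by rewrite -fE // => /(can_inj fK) [<-].
have al : a il <= 0 by apply: Rnot_lt_le => /upper_halfE.
have hb : boundary (@unit_ball n) b.
  apply: (boundary_pole_image lam0 inv hiff) => M.
    exists (set_coord a il (Rabs M + 1)); rewrite dist_set_coord.
    split; last by split_Rabs; lra.
    by apply/upper_halfE; rewrite set_coordE; split_Rabs; lra.
  exists (set_coord a il (a il - Rabs M - 1)); rewrite dist_set_coord.
  split; last by split_Rabs; lra.
  by move/upper_halfE; rewrite set_coordE; split_Rabs; lra.
(* A point of the half-space within [lam] / 2 of [a] would be sent further than 2 from [b], although
   its image lies in the ball and [b] on the unit sphere. *)
have anb : ~ boundary (@upper_half n) a.
  move=> /(_ (lam / 2)) [|[x [Hx hx]] _]; first by lra.
  have xa : x <> a by move=> e; apply: Hnota; rewrite -e.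
  have [_ _ _ /(_ x xa) e] := inv.
  have := proj1 (hiff x xa) Hx; rewrite /unit_ball vnorm_dist => hz.
  have := proj1 (boundary_unit_ball b) hb; rewrite vnorm_dist => hb1.
  have := dist_triangle (@origin n) (phi x) b; rewrite (distC (phi x) (@origin n)).
  by have := dist_ge0 x a; have := dist_ge0 (phi x) b; nra.
have hiff' z : z <> b -> (unit_ball z <-> upper_half (psi z)).
  by have [_ h _ _] := inv => zb; have [pa e] := h z zb; rewrite hiff // e.
exists a, b, lam, phi, psi; split=> //.
- by have [//|/boundary_upper_half] := al.
- by move=> p; apply: (boundary_transport lam0 inv).
- by move=> q; apply: (boundary_transport lam0 (pole_inversion_sym inv)).
Qed.

(** * Comparison of the two suprema, and extremal pairs *)

Section Comparison.
Variables (f : point n -> point n) (a b : vec n) (lam : R) (phi psi : vec n -> vec n).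
Hypothesis hf : half_ball_map f a b lam phi psi.

Lemma upper_half_neq_pole x : upper_half x -> x <> a.
Proof. by move=> /upper_halfE + e; rewrite e; have := hbm_pole hf; lra. Qed.

Lemma boundary_upper_half_neq_pole p : boundary (@upper_half n) p -> p <> a.
Proof.
move=> hp e; rewrite e in hp.
have [|[q [/upper_halfE Hq hq]] _] := hp (- a il); first by have := hbm_pole hf; lra.
by have := coord_dist q a il; split_Rabs; have := hbm_pole hf; lra.
Qed.

Lemma unit_ball_neq_pole z : unit_ball z -> z <> b.
Proof.
rewrite /unit_ball => hz e; rewrite e in hz.
by have := proj1 (boundary_unit_ball b) (hbm_image hf); lra.
Qed.

Lemma psi_unit_ball z : unit_ball z ->
  upper_half (psi z) /\ f (Some (psi z)) = Some z.
Proof.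
move=> hz; have [_ h _ _] := hbm_inv hf.
have [pa e] := h z (unit_ball_neq_pole hz).
by split; [apply/(hbm_iff hf) => //; rewrite e | rewrite (hbm_finite hf) // e].
Qed.

Lemma half_boundary_nonempty : exists p, boundary (@upper_half n) p.
Proof.
by exists (@origin n); apply: boundary_upper_half.
Qed.

Lemma half_sup x y : upper_half x -> upper_half y ->
  exists T, cassinian_sup (@upper_half n) x y T.
Proof.
move=> /upper_halfE hx /upper_halfE hy.
apply: (@cassinian_supP _ _ _ _ (Rmin (x il) (y il))); first exact: Rmin_pos.
  move=> p hp; have := upper_half_dist x hp; have := upper_half_dist y hp.
  by have := Rmin_l (x il) (y il); have := Rmin_r (x il) (y il); lra.
exact: half_boundary_nonempty.
Qed.

Lemma ball_sup z w : unit_ball z -> unit_ball w ->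
  exists T, cassinian_sup (@unit_ball n) z w T.
Proof.
rewrite /unit_ball => hz hw.
apply: (@cassinian_supP _ _ _ _ (Rmin (1 - vnorm z) (1 - vnorm w))).
- by apply: Rmin_pos; lra.
- move=> q hq; have := unit_ball_dist z hq; have := unit_ball_dist w hq.
  have := Rmin_l (1 - vnorm z) (1 - vnorm w).
  by have := Rmin_r (1 - vnorm z) (1 - vnorm w); lra.
- by exists b; apply: (hbm_image hf).
Qed.

Lemma ball_sup_le x y S T : upper_half x -> upper_half y ->
  cassinian_sup (@upper_half n) x y S ->
  cassinian_sup (@unit_ball n) (phi x) (phi y) T -> T <= 2 * S + S * S.
Proof.
move=> Hx Hy [S0 _ hS _] [_ _ _ hT]; apply: hT => q hq.
apply: (cassinian_transport (hbm_lam hf) (hbm_inv hf) (hbm_boundary_inv hf)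
  (upper_half_neq_pole Hx) (upper_half_neq_pole Hy) S0 hS _ hq).
(* The foot of [a] on the boundary hyperplane is no further from [x] and [y] than [a], so its bound
   implies the one required at the pole. *)
have hp : boundary (@upper_half n) (set_coord a il 0).
  by apply: boundary_upper_half; rewrite set_coordE.
apply: Rle_trans (hS _ hp) _; apply: Rmult_le_compat_l => //.
move/upper_halfE in Hx; move/upper_halfE in Hy; have al := hbm_pole hf.
apply: sqrt_le_1_alt; apply: Rmult_le_compat; try exact: dist_ge0;
  by apply: dist_foot; lra.
Qed.

(** The same transport applied to [psi]. Its pole [b] lies on the sphere, so the bound at the pole
    is one of those already given. *)
Lemma half_sup_le x y S T : upper_half x -> upper_half y ->
  cassinian_sup (@upper_half n) x y S ->
  cassinian_sup (@unit_ball n) (phi x) (phi y) T -> S <= 2 * T + T * T.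
Proof.
move=> Hx Hy [_ _ _ hS] [T0 _ hT _]; apply: hS => p hp.
have [hphi _ _ _] := hbm_inv hf.
have [xb ex] := hphi x (upper_half_neq_pole Hx).
have [yb ey] := hphi y (upper_half_neq_pole Hy).
rewrite -{1 2}ex -{1 2}ey.
apply: (cassinian_transport (hbm_lam hf) (pole_inversion_sym (hbm_inv hf))
  (hbm_boundary hf) xb yb T0 hT _ hp).
exact: hT (hbm_image hf).
Qed.

(** The pair is pulled back from the centre and a point at distance [eps] from it. Points of the
    sphere are at distance at least 1 - eps from both, which bounds [T]; hence S / T is nearly 2 for
    small [eps]. *)
Lemma small_ratio_pair (i0 : 'I_n) eps : 0 < eps < 1 ->
  exists x y S T, [/\ upper_half x /\ upper_half y, x <> y,
    cassinian_sup (@upper_half n) x y S,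
    cassinian_sup (@unit_ball n) (phi x) (phi y) T &
    2 * eps / (1 + eps) <= S /\ T <= eps / (1 - eps)].
Proof.
move=> [e0 e1]; pose o := @origin n; pose w := set_coord o i0 eps.
have ow : dist o w = eps.
  by rewrite distC dist_set_coord /o /origin; split_Rabs; lra.
have Bo : unit_ball o by rewrite /unit_ball vnorm_origin; lra.
have Bw : unit_ball w by rewrite /unit_ball vnorm_dist -/o ow.
have [Ho fo] := psi_unit_ball Bo; have [Hw fw] := psi_unit_ball Bw.
have [hphi hpsi _ _] := hbm_inv hf.
have [pao eo] := hpsi _ (unit_ball_neq_pole Bo).
have [paw ew] := hpsi _ (unit_ball_neq_pole Bw).
have [S hS] := half_sup Ho Hw; have [T hT] := ball_sup Bo Bw.
exists (psi o), (psi w), S, T; rewrite eo ew; split=> //.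
  by move=> /(congr1 phi); rewrite eo ew; apply: dist_neq; rewrite ow.
have hb := proj1 (boundary_unit_ball b) (hbm_image hf).
split.
(* The antipode of [b] makes |q - b| = 2, the source of the factor 2; the four other distances are
   at most 1 + eps. *)
- pose q := scale (-1) b.
  have bq : dist q b = 2.
    by rewrite /q -{2}(scale1 b) dist_scale hb; split_Rabs; lra.
  have qb : q <> b by apply: dist_neq; lra.
  have q1 : vnorm q = 1 by rewrite vnorm_scale hb; split_Rabs; lra.
  have hp := hbm_boundary_inv hf qb (proj2 (boundary_unit_ball q) q1).
  case: hS => S0 _ /(_ _ hp) hS _.
  have := proj1 (pole_inversion_ratio (hbm_lam hf) (pole_inversion_sym (hbm_inv hf)) S
    (unit_ball_neq_pole Bo) (unit_ball_neq_pole Bw) qb) hS.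
  rewrite -/o ow bq -!vnorm_dist hb q1 !Rmult_1_l.
  have h1 : dist w q <= 1 + eps.
    by have := dist_triangle o w q; rewrite (distC w o) ow -vnorm_dist q1; lra.
  have h2 : dist w b <= 1 + eps.
    by have := dist_triangle o w b; rewrite (distC w o) ow -vnorm_dist hb; lra.
  have : sqrt (dist w q) * sqrt (dist w b) <= 1 + eps.
    rewrite -(sqrt_square (1 + eps)); last by lra.
    rewrite -sqrt_mult_alt; last exact: dist_ge0.
    by apply: sqrt_le_1_alt; apply: Rmult_le_compat => //; apply: dist_ge0.
  move=> h3 h4; have h5 := Rmult_le_compat_l _ _ _ S0 h3.
  apply: (Rmult_le_reg_r (1 + eps)); first by lra.
  have -> : 2 * eps / (1 + eps) * (1 + eps) = eps * 2 by field; lra.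
  lra.
- case: hT => _ _ _; apply=> q hq; rewrite ow.
  have h1 := unit_ball_dist o hq; have h2 := unit_ball_dist w hq.
  rewrite vnorm_origin in h1; rewrite vnorm_dist -/o ow in h2.
  have {1}-> : eps = eps / (1 - eps) * (1 - eps) by field; lra.
  apply: Rmult_le_compat_l.
    by apply: Rlt_le; apply: Rdiv_lt_0_compat; lra.
  rewrite -{1}(sqrt_square (1 - eps)); last by lra.
  by apply: sqrt_le_1_alt; apply: Rmult_le_compat; lra.
Qed.

(* [y] mirrors the pole in the boundary, at height [h], and [x] is [y]
   translated horizontally by [2 h m ^ 2]. *)
Lemma large_ratio_pair (i0 : 'I_n) m : i0 != il -> 1 <= m ->
  exists x y S T, [/\ upper_half x /\ upper_half y, x <> y,
    cassinian_sup (@upper_half n) x y S,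
    cassinian_sup (@unit_ball n) (phi x) (phi y) T &
    S <= 2 * m /\ m * m / 2 <= T].
Proof.
move=> i0l m1; have al := hbm_pole hf.
pose h := - a il; have h0 : 0 < h by rewrite /h; lra.
pose D := 2 * h * (m * m).
have D0 : 0 < D by apply: Rmult_lt_0_compat; nra.
pose y := set_coord a il h; pose x := set_coord y i0 (y i0 + D).
pose p := set_coord x il 0.
have yil : y il = h by rewrite /y set_coordE.
have xil : x il = h by rewrite /x set_coord_neq 1?eq_sym // yil.
have Hx : upper_half x by apply/upper_halfE; rewrite xil.
have Hy : upper_half y by apply/upper_halfE; rewrite yil.
have xy : dist x y = D by rewrite dist_set_coord; split_Rabs; lra.
have ya : dist y a = 2 * h by rewrite dist_set_coord /h; split_Rabs; lra.
have xp : dist x p = h by rewrite distC dist_set_coord xil; split_Rabs; lra.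
have hp : boundary (@upper_half n) p by apply: boundary_upper_half; rewrite /p set_coordE.
have pa : D <= dist p a.
  have := coord_dist p a i0; rewrite /p set_coord_neq // /x set_coordE.
  by rewrite /y set_coord_neq //; split_Rabs; lra.
have xa : dist x a <= D + 2 * h by have := dist_triangle y x a; lra.
have yp : dist y p <= D + 2 * h by have := dist_triangle x y p; rewrite (distC y x); lra.
have [S hS] := half_sup Hx Hy.
have [T hT] := ball_sup (proj1 (hbm_iff hf (upper_half_neq_pole Hx)) Hx)
  (proj1 (hbm_iff hf (upper_half_neq_pole Hy)) Hy).
exists x, y, S, T; split=> //; first by apply: dist_neq; rewrite xy.
split.
(* Every boundary point is at distance at least [h] from both points and at least D / 2 from one of
   them, and h D / 2 = (h m)^2. *)
- case: hS => _ _ _; apply=> q hq.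
  have h1 := upper_half_dist x hq; have h2 := upper_half_dist y hq.
  rewrite xil in h1; rewrite yil in h2.
  have := dist_triangle q x y; rewrite xy (distC q) => h3.
  have -> : D = 2 * m * (h * m) by rewrite /D; ring.
  apply: Rmult_le_compat_l; first by lra.
  rewrite -(sqrt_square (h * m)); last by nra.
  apply: sqrt_le_1_alt.
  have -> : h * m * (h * m) = h * (D / 2) by rewrite /D; field.
  have [h4|h4] : D / 2 <= dist x q \/ D / 2 <= dist y q by lra.
    by rewrite Rmult_comm; apply: Rmult_le_compat; lra.
  by apply: Rmult_le_compat; lra.
(* Test at the image of [p], the foot of [x]: |p - a| is at least [D], while |y - p| and |x - a| are
   at most D + 2 h. This gives D^2 <= 2 h (D + 2 h) T, that is, m^4 <= (m^2 + 1) T. *)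
- case: hT => T0 _ /(_ _ (hbm_boundary hf (boundary_upper_half_neq_pole hp) hp)) hT _.
  have := proj1 (pole_inversion_ratio (hbm_lam hf) (hbm_inv hf) T
    (upper_half_neq_pole Hx) (upper_half_neq_pole Hy)
    (boundary_upper_half_neq_pole hp)) hT.
  rewrite xy xp ya => h1.
  have h2 : sqrt (h * dist y p) * sqrt (dist x a * (2 * h)) <= 2 * h * (D + 2 * h).
    rewrite -(sqrt_square (2 * h * (D + 2 * h))); last by nra.
    have yp0 := dist_ge0 y p; have xa0 := dist_ge0 x a.
    rewrite -sqrt_mult_alt; last by nra.
    apply: sqrt_le_1_alt.
    have : dist y p * dist x a <= (D + 2 * h) * (D + 2 * h).
      by apply: Rmult_le_compat.
    set c := _ * dist x a; set d := _ * (D + 2 * h) => hcd.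
    have -> : h * dist y p * (dist x a * (2 * h)) = 2 * (h * h) * c by rewrite /c; ring.
    have -> : 2 * h * (D + 2 * h) * (2 * h * (D + 2 * h)) = 4 * (h * h) * d.
      by rewrite /d; ring.
    have c0 : 0 <= c by apply: Rmult_le_pos.
    have hh : 0 < h * h by nra.
    by apply: Rmult_le_compat; nra.
  have h3 := Rmult_le_compat_l _ _ _ T0 h2.
  have h4 : D * D <= D * dist p a by apply: Rmult_le_compat_l; lra.
  have h5 : D * D <= T * (2 * h * (D + 2 * h)) by lra.
  have h6 : (4 * (h * h)) * (m * m * (m * m)) <= (4 * (h * h)) * (T * (m * m + 1)).
    by move: h5; rewrite /D; lra.
  have h7 := Rmult_le_reg_l _ _ _ (ltac:(nra) : 0 < 4 * (h * h)) h6.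
  have mm : 1 <= m * m by nra.
  apply: (Rmult_le_reg_r (m * m)); first by lra.
  have : T * (m * m + 1) <= T * (2 * (m * m)) by apply: Rmult_le_compat_l; lra.
  lra.
Qed.

End Comparison.
End HalfSpace.

(** * Logarithmic estimates and the sharp constants *)

Lemma ln_mono x y : 0 < x -> x <= y -> ln x <= ln y.
Proof. by move=> x0 [h|->]; [apply: Rlt_le; apply: ln_increasing | right]. Qed.

Lemma ln_le_double S T : 0 <= S -> 0 <= T -> T <= 2 * S + S * S ->
  ln (1 + T) <= 2 * ln (1 + S).
Proof.
move=> S0 T0 h.
have -> : 2 * ln (1 + S) = ln ((1 + S) * (1 + S)) by rewrite ln_mult; lra.
by apply: ln_mono; nra.
Qed.

Lemma ln_1p_gt0 t : 0 < t -> 0 < ln (1 + t).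
Proof. by move=> t0; rewrite -ln_1; apply: ln_increasing; lra. Qed.

Lemma ln_1p_le t : 0 <= t -> ln (1 + t) <= t.
Proof.
move=> t0; rewrite -{2}(ln_exp t).
by apply: ln_mono; [lra | apply: exp_ineq1_le].
Qed.

(** From exp u >= 1 + u at u = - ln (1 + t). *)
Lemma ln_1p_ge t : 0 <= t -> t / (1 + t) <= ln (1 + t).
Proof.
move=> t0; have h0 : 0 < / (1 + t) by apply: Rinv_0_lt_compat; lra.
have : ln (/ (1 + t)) <= / (1 + t) - 1.
  by rewrite -{2}(exp_ln _ h0); have := exp_ineq1_le (ln (/ (1 + t))); lra.
rewrite ln_Rinv; last by lra.
have -> : t / (1 + t) = 1 - / (1 + t) by field; lra.
lra.
Qed.

Theorem theorem5p3 (n : nat) (hn : leq 2 n) (f : point n -> point n)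
  (hf : mobius f)
  (hHB : forall x, upper_half x -> exists z, f (Some x) = Some z /\ unit_ball z)
  (hBH : forall z, unit_ball z -> exists x, upper_half x /\ f (Some x) = Some z) :
  (forall (x y fx fy : vec n), upper_half x -> upper_half y ->
      f (Some x) = Some fx -> f (Some y) = Some fy ->
      / 2 * cassinian_tilde (@upper_half n) x y <= cassinian_tilde (@unit_ball n) fx fy
      /\ cassinian_tilde (@unit_ball n) fx fy <= 2 * cassinian_tilde (@upper_half n) x y)
  /\ is_glb (fun v => exists (x y fx fy : vec n), upper_half x /\ upper_half y /\ x <> y /\
               f (Some x) = Some fx /\ f (Some y) = Some fy /\
               v = cassinian_tilde (@unit_ball n) fx fy / cassinian_tilde (@upper_half n) x y)
            (/ 2)
  /\ is_lub (fun v => exists (x y fx fy : vec n), upper_half x /\ upper_half y /\ x <> y /\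
               f (Some x) = Some fx /\ f (Some y) = Some fy /\
               v = cassinian_tilde (@unit_ball n) fx fy / cassinian_tilde (@upper_half n) x y)
            2.
Proof.
have n0 : is_true (leq 1 n) by apply: leq_trans hn.
have nl : is_true (leq n.-1.+1 n) by rewrite prednK.
(* Since n >= 2, the first coordinate [i0] differs from the last, [il], and gives a horizontal
   direction. *)
pose il := Ordinal nl; pose i0 := Ordinal n0.
have il_last : nat_of_ord il = n.-1 by [].
have i0l : i0 != il by rewrite -val_eqE /= eq_sym -lt0n -ltnS prednK.
have [a [b [lam [phi [psi hm]]]]] := mobius_half_ball_map il_last i0l hf hHB hBH.
have fE x fx : upper_half x -> f (Some x) = Some fx -> fx = phi x.
  move=> Hx; rewrite (hbm_finite hm); first by case.
  exact: (upper_half_neq_pole il_last hm).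
have fphi x : upper_half x -> f (Some x) = Some (phi x).
  by move=> Hx; apply: (hbm_finite hm); apply: (upper_half_neq_pole il_last hm).
have Bphi x : upper_half x -> unit_ball (phi x).
  by move=> Hx; apply/(hbm_iff hm) => //; apply: (upper_half_neq_pole il_last hm).
have bounds x y : upper_half x -> upper_half y ->
    / 2 * cassinian_tilde (@upper_half n) x y
      <= cassinian_tilde (@unit_ball n) (phi x) (phi y)
      <= 2 * cassinian_tilde (@upper_half n) x y.
  move=> Hx Hy; have [S hS] := half_sup il_last Hx Hy.
  have [T hT] := ball_sup hm (Bphi x Hx) (Bphi y Hy).
  have h1 := ball_sup_le il_last hm Hx Hy hS hT.
  have h2 := half_sup_le il_last hm Hx Hy hS hT.
  have [S0 -> _ _] := hS; have [T0 -> _ _] := hT.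
  by have := ln_le_double S0 T0 h1; have := ln_le_double T0 S0 h2; lra.
have pos x y : upper_half x -> upper_half y -> x <> y ->
    0 < cassinian_tilde (@upper_half n) x y.
  move=> Hx Hy xy; have [S hS] := half_sup il_last Hx Hy.
  have S0 := cassinian_sup_gt0 hS (half_boundary_nonempty il_last) xy.
  by have [_ -> _ _] := hS; apply: ln_1p_gt0.
pose tH := cassinian_tilde (@upper_half n); pose tB := cassinian_tilde (@unit_ball n).
have div_mul u v : 0 < v -> u = u / v * v by move=> v0; field; lra.
split; first by move=> x y fx fy Hx Hy /fE -> // /fE -> //; have [] := bounds x y Hx Hy.
split; split.
- move=> v [x [y [fx [fy [Hx [Hy [xy [/(fE _ _ Hx) -> [/(fE _ _ Hy) -> ->]]]]]]]]].
  have p0 := pos x y Hx Hy xy; apply: (Rmult_le_reg_r _ _ _ p0).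
  by rewrite -div_mul //; have := bounds x y Hx Hy; lra.
- move=> c hc; apply: Rnot_lt_le => c2.
  (* The pair below forces 2 c (1 - eps) <= 1 + 3 eps, which fails for [eps] below (2 c - 1) / (3 +
     2 c); half of that threshold is taken. *)
  pose eps := (2 * c - 1) / (2 * (3 + 2 * c)).
  have e0 : 0 < eps by apply: Rdiv_lt_0_compat; lra.
  have e_eq : eps * (2 * (3 + 2 * c)) = 2 * c - 1 by rewrite /eps; field; lra.
  have e1 : eps < 1 by nra.
  have [x [y [S [T [[Hx Hy] xy hS hT [hSl hTu]]]]]] :=
    small_ratio_pair il_last hm i0 (conj e0 e1).
  have p0 := pos x y Hx Hy xy.
  have : c <= tB (phi x) (phi y) / tH x y.
    by apply: hc; exists x, y, (phi x), (phi y); do !split => //; apply: fphi.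
  move/(Rmult_le_compat_r _ _ _ (Rlt_le _ _ p0)); rewrite -div_mul // /tB /tH.
  have [S0 -> _ _] := hS; have [T0 -> _ _] := hT => hcST.
  pose S1 := 2 * eps / (1 + eps).
  have S1pos : 0 < S1 by apply: Rdiv_lt_0_compat; lra.
  have hS1 : 2 * eps / (1 + 3 * eps) <= ln (1 + S).
    have -> : 2 * eps / (1 + 3 * eps) = S1 / (1 + S1) by rewrite /S1; field; lra.
    apply: Rle_trans (ln_1p_ge (Rlt_le _ _ S1pos)) _.
    by apply: ln_mono; rewrite -/S1 in hSl; lra.
  have hT1 := Rle_trans _ _ _ (ln_1p_le T0) hTu.
  have hS2 : c * (2 * eps / (1 + 3 * eps)) <= c * ln (1 + S).
    by apply: Rmult_le_compat_l; lra.
  have h : c * (2 * eps / (1 + 3 * eps)) <= eps / (1 - eps) by lra.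
  have k0 : 0 <= (1 + 3 * eps) * (1 - eps) / eps.
    by apply: Rlt_le; apply: Rdiv_lt_0_compat => //; apply: Rmult_lt_0_compat; lra.
  have := Rmult_le_compat_r _ _ _ k0 h.
  have -> : c * (2 * eps / (1 + 3 * eps)) * ((1 + 3 * eps) * (1 - eps) / eps)
    = 2 * c * (1 - eps) by field; lra.
  have -> : eps / (1 - eps) * ((1 + 3 * eps) * (1 - eps) / eps) = 1 + 3 * eps.
    by field; lra.
  by lra.
- move=> v [x [y [fx [fy [Hx [Hy [xy [/(fE _ _ Hx) -> [/(fE _ _ Hy) -> ->]]]]]]]]].
  have p0 := pos x y Hx Hy xy; apply: (Rmult_le_reg_r _ _ _ p0).
  by rewrite -div_mul //; have := bounds x y Hx Hy; lra.
- move=> c hc; apply: Rnot_lt_le => c2.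
  (* Here [u] is the half-space distance of the pair: 1 + S <= 3 m and 1 + T >= m^2 / 2. The last
     conjunct records the lower bound 1/2 on the ratio. *)
  have key m : 1 <= m -> exists u, [/\ 0 < u, u <= ln 3 + ln m,
      2 * ln m - ln 2 <= c * u & / 2 * u <= c * u].
    move=> m1.
    have [x [y [S [T [[Hx Hy] xy hS hT [hSu hTl]]]]]] :=
      large_ratio_pair il_last hm i0l m1.
    have p0 := pos x y Hx Hy xy; have [hb _] := bounds x y Hx Hy.
    have : tB (phi x) (phi y) / tH x y <= c.
      by apply: hc; exists x, y, (phi x), (phi y); do !split => //; apply: fphi.
    move/(Rmult_le_compat_r _ _ _ (Rlt_le _ _ p0)); rewrite -div_mul // => hcST.
    exists (tH x y); split => //; last by apply: Rle_trans hb hcST.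
      rewrite /tH -ln_mult; [|lra|lra]; have [S0 -> _ _] := hS.
      by apply: ln_mono; lra.
    apply: Rle_trans hcST; rewrite /tB; have [T0 -> _ _] := hT.
    have -> : 2 * ln m - ln 2 = ln (m * m / 2).
      by rewrite ln_mult ?ln_mult ?ln_Rinv; nra.
    by apply: ln_mono; nra.
  (* Positivity of [c] is what allows the upper bound on [u] to be multiplied by [c]. *)
  have c0 : / 2 <= c.
    have [u [u0 _ _ hu]] := key 1 (Rle_refl 1).
    exact: Rmult_le_reg_r hu.
  have l2 : 0 < ln 2 by rewrite -ln_1; apply: ln_increasing; lra.
  have l3 : 0 < ln 3 by rewrite -ln_1; apply: ln_increasing; lra.
  (* With ln m = L one gets 2 L - ln 2 = c (ln 3 + L) + 1, exceeding by 1 what [key] permits. *)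
  pose L := (c * ln 3 + ln 2 + 1) / (2 - c).
  have L0 : 0 < L by apply: Rdiv_lt_0_compat; nra.
  have eL : L * (2 - c) = c * ln 3 + ln 2 + 1 by rewrite /L; field; lra.
  have [|u [_ hu hcu _]] := key (exp L); first by have := exp_ineq1_le L; lra.
  move: hu hcu; rewrite ln_exp => hu hcu.
  have : c * u <= c * (ln 3 + L) by apply: Rmult_le_compat_l; lra.
  by lra.
Qed.
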